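(* For nonnegative integers $i,j$, say $i$ is free of $j$ if the binary expansion of $i$ has 0s in all positions where the binary expansion of $j$ has 1s. Let $b(n)$ denote the sum of the binary digits of a nonnegative integer $n$. For an indeterminate $x$, let $S(x)=(S(x)_{ij})_{i,j\ge0}$ be the infinite lower-triangular matrix with $S(x)_{ij}=x^{b(i-j)}$ if $i\ge j\ge 0$ and $i-j$ is free of $j$, and $S(x)_{ij}=0$ otherwise. Then for indeterminates $x,y$, $$S(x)\,S(y)=S(x+y).$$
   Context: Products of infinite lower-triangular matrices are defined by the usual formula, each entry being a finite sum; entries are polynomials in $x,y$. *)

(* Defs.v *)
From mathcomp Require Import all_boot all_order all_algebra.

Set Implicit Arguments.
Unset Strict Implicit.
Unset Printing Implicit Defensive.

Import GRing.Theory.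
Local Open Scope nat_scope.

(** [bdigit n k] tells whether the binary digit of [n] of weight [2 ^ k] is 1. *)
Definition bdigit (n k : nat) : bool := odd (n %/ 2 ^ k).

Lemma bdigit_lt (n k : nat) : bdigit n k -> k < n.
Proof.
apply: contraTT; rewrite -leqNgt => le_nk.
by rewrite /bdigit divn_small // (leq_ltn_trans le_nk) // ltn_expl.
Qed.

(** The positions [k < n] suffice because of [bdigit_lt]; each digit is coerced
    from [bool] to [nat]. *)
Definition bsum (n : nat) : nat := \sum_(k < n) bdigit n k.

Lemma bdigitsE (n : nat) : n = \sum_(k < n) bdigit n k * 2 ^ k.
Proof.
suff H m : n = n %/ 2 ^ m * 2 ^ m + \sum_(k < m) bdigit n k * 2 ^ k.
  by rewrite [LHS](H n) divn_small ?mul0n ?add0n // ltn_expl.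
elim: m => [|m IHm]; first by rewrite big_ord0 expn0 divn1 muln1 addn0.
rewrite big_ord_recr /= {1}IHm addnCA addnC; congr (_ + _).
rewrite /bdigit expnSr divnMA (mulnC _ 2) mulnA divn2 muln2.
by rewrite -mulnDl addnC odd_double_half.
Qed.

(** [free_of i j]: [i] has digit 0 wherever [j] has digit 1. *)
Definition free_of (i j : nat) : bool :=
  [forall k : 'I_j, bdigit j k ==> ~~ bdigit i k].

Lemma free_ofP (i j : nat) :
  reflect (forall k, bdigit j k -> bdigit i k = false) (free_of i j).
Proof.
apply: (iffP forallP) => [H k jk | H k]; last by apply/implyP => /H ->.
by apply/negbTE; have /implyP := H (Ordinal (bdigit_lt jk)); apply.
Qed.

Local Open Scope ring_scope.

Definition infmx (R : Type) : Type := nat -> nat -> R.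

Definition lower_triangular (R : nmodType) (A : infmx R) : Prop :=
  forall i j : nat, (i < j)%N -> A i j = 0.

(** When [A] is lower-triangular, [A i k = 0] for [k > i], so the formal sum
    over all [k] reduces to [k <= i]; see [infmx_mulE]. *)
Definition infmx_mul (R : pzSemiRingType) (A B : infmx R) : infmx R :=
  fun i j => \sum_(k < i.+1) A i k * B k j.

Lemma infmx_mulE (R : pzSemiRingType) (A B : infmx R) (i j n : nat) :
  lower_triangular A -> (i < n)%N ->
  infmx_mul A B i j = \sum_(k < n) A i k * B k j.
Proof.
move=> ltA lt_in; rewrite /infmx_mul.
rewrite (big_ord_widen n (fun k => A i k * B k j) lt_in) big_mkcond /=.
apply: eq_bigr => k _; case: ifPn => //; rewrite ltnS -ltnNge => lt_ik.
by rewrite ltA // mul0r.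
Qed.

Definition Smx (R : pzSemiRingType) (x : R) : infmx R :=
  fun i j => if (j <= i)%N && free_of (i - j) j then x ^+ bsum (i - j) else 0.

Lemma Smx_lower_triangular (R : pzSemiRingType) (x : R) :
  lower_triangular (Smx x).
Proof. by move=> i j lt_ij; rewrite /Smx leqNgt lt_ij. Qed.

(* Main.v *)
(** Splitting off the last binary digit of the indices exhibits [Smx x] as the
    Kronecker product of [Smx x] with the 2x2 matrix [[1, 0], [x, 1]].  These
    2x2 matrices multiply by adding [x] and [y], so the identity follows by
    induction on the row index. *)

Require Import Defs.
From HB Require Import structures.
From mathcomp Require Import all_boot all_order all_algebra.
From mathcomp Require Import mpoly.

Import GRing.Theory.
Local Open Scope ring_scope.

Lemma bdigit_double0 (a : bool) (n : nat) : bdigit (a + n.*2) 0 = a.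
Proof. by rewrite /bdigit expn0 divn1 oddD odd_double addbF oddb. Qed.

Lemma bdigit_doubleS (a : bool) (n k : nat) :
  bdigit (a + n.*2) k.+1 = bdigit n k.
Proof. by rewrite /bdigit expnS divnMA divn2 half_bit_double. Qed.

(** Digits at positions [k >= n] vanish, so the digit sums of different numbers can be compared over
    a common range. *)
Lemma bsum_widen (n m : nat) :
  (n <= m)%N -> bsum n = (\sum_(k < m) bdigit n k)%N.
Proof.
move=> le_nm; rewrite /bsum (big_ord_widen m (fun k => bdigit n k : nat) le_nm).
rewrite big_mkcond /=; apply: eq_bigr => k _.
by case: ifPn => // /(contraNN (@bdigit_lt n k)) /negbTE ->.
Qed.

Lemma bsum_double (a : bool) (n : nat) : bsum (a + n.*2) = (a + bsum n)%N.
Proof.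
rewrite (@bsum_widen _ (a + n.*2).+1) // big_ord_recl bdigit_double0.
congr (_ + _)%N; rewrite (@bsum_widen n (a + n.*2)); last first.
  by rewrite -addnn addnCA leq_addr.
by apply: eq_bigr => k _; rewrite bdigit_doubleS.
Qed.

Lemma free_of_double (a b : bool) (i j : nat) :
  free_of (a + i.*2) (b + j.*2) = ~~ (a && b) && free_of i j.
Proof.
apply/free_ofP/andP => [free_ij | [nab /free_ofP free_ij] [|k]]; last 2 first.
- by rewrite !bdigit_double0; case: a b nab => [] [].
- by rewrite !bdigit_doubleS; apply: free_ij.
split; last first.
  by apply/free_ofP => k; have := free_ij k.+1; rewrite !bdigit_doubleS.
by have := free_ij 0; rewrite !bdigit_double0; case: a b {free_ij} => [] [] // ->.
Qed.

(** The factor [if b then a%:R else x ^+ a] is the entry in row [a], column [b] of [[1, 0],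
    [x, 1]]. *)
Lemma Smx_double (R : pzSemiRingType) (x : R) (a b : bool) (i j : nat) :
  Smx x (a + i.*2)%N (b + j.*2)%N = (if b then a%:R else x ^+ a) * Smx x i j.
Proof.
have [le_ji | lt_ij] := leqP j i; last first.
  rewrite !Smx_lower_triangular ?mulr0 //.
  apply: leq_trans (leq_addl _ _).
  by case: a; rewrite ?ltn_Sdouble ?ltn_double.
rewrite -(subnK le_ji); move: (i - j)%N => d {i le_ji}.
(* For [b = 1], [a = 0], the difference of the indices is odd, like the column index, so freeness
   fails at the last digit. *)
have [/andP[-> /negbTE ->] | ] := boolP (b && ~~ a).
  rewrite mul0r /Smx; case: d => [|d]; first by rewrite !add0n ltnn.
  have -> : (false + (d.+1 + j).*2 = true + d.*2 + (true + j.*2))%N.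
    by rewrite doubleD doubleS add0n !add1n addnS.
  by rewrite addnK (free_of_double true true) andbF.
rewrite negb_and negbK => ab; rewrite /Smx leq_addl addnK /=.
(* In the other cases no borrow occurs: the difference has last digit [a (+) b], and its half is
   [d]. *)
have -> : (a + (d + j).*2 = (a (+) b) + d.*2 + (b + j.*2))%N.
  by rewrite doubleD [RHS]addnACA; case: a b ab => [] [].
rewrite leq_addl addnK (free_of_double (a (+) b) b) bsum_double.
by case: a b ab => [] [] //= _; case: ifP; rewrite ?mulr0 ?mul1r ?exprD.
Qed.

Lemma big_ord_double (R : nmodType) (n : nat) (F : nat -> R) :
  \sum_(k < n.*2) F k = \sum_(k < n) (F k.*2 + F k.*2.+1).
Proof.
elim: n => [|n IHn]; first by rewrite !big_ord0.
by rewrite doubleS !big_ord_recr /= IHn addrA.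
Qed.

Lemma Smx_mul (R : comPzSemiRingType) (x y : R) :
  infmx_mul (Smx x) (Smx y) =2 Smx (x + y).
Proof.
elim/ltn_ind => i IHi j; case: i IHi => [_ | i IHi].
  rewrite /infmx_mul big_ord1 /Smx subnn sub0n /bsum big_ord0 !expr0.
  have -> : free_of 0 0 by apply/forallP => -[].
  by case: ifP; rewrite ?mulr1 ?mulr0.
(* An even number of terms lets the sum split into pairs [k.*2], [k.*2.+1]; any term beyond index
   [n] vanishes by triangularity. *)
set n := i.+1; have lt_n : (n < n./2.+1.*2)%N.
  by rewrite -[X in (X < _)%N]odd_double_half doubleS -add2n ltn_add2r; case: odd.
have {IHi} IHn : infmx_mul (Smx x) (Smx y) n./2 j./2 = Smx (x + y) n./2 j./2.
  by apply: IHi; rewrite -divn2 ltn_Pdiv.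
clearbody n; rewrite (infmx_mulE _ _ (@Smx_lower_triangular _ x) lt_n).
rewrite (big_ord_double _ _ (fun k => Smx x n k * Smx y k j)).
have SxE (z : R) k l : Smx z k l =
    (if odd l then (odd k)%:R else z ^+ odd k) * Smx z k./2 l./2.
  by rewrite -[in LHS](odd_double_half k) -[in LHS](odd_double_half l) Smx_double.
rewrite [RHS]SxE -IHn /infmx_mul mulr_sumr; apply: eq_bigr => k _.
rewrite ![Smx _ _ j]SxE ![Smx _ n _]SxE /= odd_double doubleK uphalf_double /=.
(* These are the four entries of the 2x2 product. Only [n] odd, [j] even gives two nonzero factors,
   [x] and [y]; commutativity then moves [y] to the front. *)
case: (odd n) (odd j) => [] [];
  rewrite /= ?expr1 ?expr0 ?mul1r ?mul0r ?mulr0 ?add0r ?addr0 //.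
by rewrite mulrDl -!mulrA [Smx x _ _ * (y * _)]mulrCA.
Qed.

Theorem theorem2 (R : comNzRingType) :
  let x : {mpoly R[2]} := 'X_(0 : 'I_2) in
  let y : {mpoly R[2]} := 'X_(1 : 'I_2) in
  infmx_mul (Smx x) (Smx y) =2 Smx (x + y).
Proof. exact: Smx_mul. Qed.
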